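(* Let $(Y,\le_Y)$ be a nonempty partially ordered set. The following statements are equivalent. (i) $(Y,\le_Y)$ is a complete lattice. (ii) For every poset $(X,\le_X)$ and every $A\subseteq X$, every isotone map $f\colon A\to Y$ has a lower isotone extension. (iii) For every poset $(X,\le_X)$ and every $A\subseteq X$, every isotone map $f\colon A\to Y$ has an upper isotone extension. (iv) For every poset $(X,\le_X)$ and every $A\subseteq X$, every isotone map $f\colon A\to Y$ has an isotone extension.
   Context: A map $f\colon X\to Y$ between posets is isotone if $x\le_X y$ implies $f(x)\le_Y f(y)$. A subset $A\subseteq X$ carries the order induced from $X$. For $A\subseteq X$ and isotone $f\colon A\to Y$, an isotone extension of $f$ is an isotone map $\Psi\colon X\to Y$ with $\Psi(a)=f(a)$ for all $a\in A$. An isotone extension $\Psi$ of $f$ is called upper (resp. lower) if for every isotone extension $\chi\colon X\to Y$ of $f$ and every $x\in X$ one has $\chi(x)\le_Y\Psi(x)$ (resp. $\Psi(x)\le_Y\chi(x)$). A complete lattice is a poset in which every nonempty subset has both a supremum and an infimum. *)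

(* Defs.v *)
From HB Require Import structures.
From mathcomp Require Import all_boot all_order boolp classical_sets.

Set Implicit Arguments.
Unset Strict Implicit.
Unset Printing Implicit Defensive.

Local Open Scope classical_set_scope.

(* A subset carries the induced order: [a <= b] iff [\val a <= \val b], by
   [Order.le_val]. The instance applies to [A : set X], whose coercion to a
   type unfolds to [{x : X | x \in A}]. *)
HB.instance Definition _ (d : Order.disp_t) (X : porderType d) (P : pred X) :=
  [SubChoice_isSubPOrder of {x : X | P x} by <: with d].

Definition isotone_extension (dX dY : Order.disp_t) (X : porderType dX)
    (Y : porderType dY) (A : set X) (f : A -> Y) (Psi : X -> Y) : Prop :=
  Order.nondecreasing Psi /\ forall a : A, Psi (\val a) = f a.

Definition lower_isotone_extension (dX dY : Order.disp_t) (X : porderType dX)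
    (Y : porderType dY) (A : set X) (f : A -> Y) (Psi : X -> Y) : Prop :=
  isotone_extension f Psi /\
  forall chi : X -> Y, isotone_extension f chi ->
    forall x : X, (Psi x <= chi x)%O.

Definition upper_isotone_extension (dX dY : Order.disp_t) (X : porderType dX)
    (Y : porderType dY) (A : set X) (f : A -> Y) (Psi : X -> Y) : Prop :=
  isotone_extension f Psi /\
  forall chi : X -> Y, isotone_extension f chi ->
    forall x : X, (chi x <= Psi x)%O.

(* Only nonempty subsets are required to have bounds, so the empty poset
   qualifies. *)
Definition complete_lattice (d : Order.disp_t) (Y : porderType d) : Prop :=
  forall S : set Y, S !=set0 -> supremums S !=set0 /\ infimums S !=set0.

(* Main.v *)
(* In a complete lattice, [x |-> sup {f a | a <= x}] is the least isotone
   extension, where [sup set0] is the least element of the nonempty [Y]; dually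
   for the greatest one. Conversely, given [S <= T] elementwise in [Y], adjoin to
   [Y] a new point between [S] and [T] and extend the identity of [Y] to it: the
   image of the point lies between [S] and [T]. Applied to [S] and its upper
   bounds this yields [sup S], and applied to the lower bounds of [S] and [S] it
   yields [inf S]. *)
Require Import Defs.
From HB Require Import structures.
From mathcomp Require Import all_boot all_order boolp classical_sets.

Set Implicit Arguments.
Unset Strict Implicit.
Unset Printing Implicit Defensive.

Import Order.Theory.
Local Open Scope classical_set_scope.
Local Open Scope order_scope.

Lemma supremumsP (d : Order.disp_t) (T : porderType d) (S : set T) (z : T) :
  supremums S z <-> forall u, z <= u <-> ubound S u.
Proof.
split=> [[ub_z lb_z] u|zP].
  by split=> [zu x /ub_z /le_trans|/lb_z]; first exact.
by split=> [|u /zP//]; apply/zP.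
Qed.

(** Every point is an upper bound of the empty set, so its supremum is the least element. This
    covers the empty set, on which [complete_lattice] is silent. *)
Lemma supremums_set0 (d : Order.disp_t) (T : porderType d) (z : T) :
  infimums [set: T] z -> supremums set0 z.
Proof. by move=> [lb_z _]; apply/supremumsP=> u; split=> _; [move=> x []|apply: lb_z]. Qed.

Lemma lower_isotone_extension_sup (dX dY : Order.disp_t) (X : porderType dX)
    (Y : porderType dY) (A : set X) (f : A -> Y) :
    (forall S : set Y, supremums S !=set0) -> Order.nondecreasing f ->
  exists Psi : X -> Y, lower_isotone_extension f Psi.
Proof.
move=> supY f_homo.
pose below x := [set f a | a in [set a : A | \val a <= x]].
have [Psi PsiP] := choice (fun x => supY (below x)).
have {}PsiP x u : Psi x <= u <-> forall a : A, \val a <= x -> f a <= u.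
  rewrite (supremumsP _ _).1//; split=> [ub a ax|ub _ [a ax <-]]; last exact: ub.
  by apply: ub; exists a.
exists Psi; split; first split.
- move=> x y xy; apply/PsiP => a ax.
  by apply: (PsiP y _).1 (le_trans ax xy).
(* As [f] is isotone, [f a] is the largest value of [f] on the points of [A] below [\val a]. *)
- move=> a; apply/le_anti/andP; split; last exact: (PsiP (\val a) _).1.
  by apply/PsiP => b ba; apply: f_homo.
- move=> chi [chi_homo chiE] x; apply/PsiP => a ax.
  by rewrite -chiE; apply: chi_homo.
Qed.

(** Order duality: reversing both orders keeps isotone maps isotone and exchanges infima with
    suprema, lower extensions with upper ones. *)
Lemma upper_isotone_extension_inf (dX dY : Order.disp_t) (X : porderType dX)
    (Y : porderType dY) (A : set X) (f : A -> Y) :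
    (forall S : set Y, infimums S !=set0) -> Order.nondecreasing f ->
  exists Psi : X -> Y, upper_isotone_extension f Psi.
Proof.
move=> infY f_homo.
have [|Psi [[Psi_homo PsiE] Psi_lower]] :=
  @lower_isotone_extension_sup _ _ X^d Y^d A f infY.
  by move=> a b; apply: f_homo.
exists Psi; split; first by split=> // x y; apply: Psi_homo.
move=> chi [chi_homo chiE]; apply: Psi_lower; split=> // x y.
exact: chi_homo.
Qed.

Lemma isotone_extension_interpolation (d : Order.disp_t) (Y : porderType d)
    (S T : set Y) :
    (forall (X : porderType d) (A : set X) (f : A -> Y),
      Order.nondecreasing f -> exists Psi : X -> Y, isotone_extension f Psi) ->
    (forall s t, S s -> T t -> s <= t) ->
  exists z, ubound S z /\ lbound T z.
Proof.
move=> ext leST.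
(* Closing [S] downward and [T] upward is what makes the order [le] below transitive. *)
pose L := [set a | exists2 s, S s & a <= s].
pose U := [set b | exists2 t, T t & t <= b].
have leLU a b : L a -> U b -> a <= b.
  by move=> [s Ss als] [t Tt tb]; rewrite (le_trans als)// (le_trans _ tb)// leST.
(* A common point of [L] and [U] already lies between [S] and [T]. *)
have [[b [Lb Ub]]|LU0] := pselect (L `&` U !=set0).
  exists b; split=> [s Ss|t Tt]; first by apply: leLU => //; exists s.
  by apply: leLU => //; exists t.
(* [None] is the new point; antisymmetry relies on [L] and [U] being disjoint. *)
pose le (x y : option Y) := match x, y with
  | Some a, Some b => a <= b
  | Some a, None => `[< L a >]
  | None, Some b => `[< U b >]
  | None, None => true
  end.
have le_refl : reflexive le by case=> /=.
have le_anti : antisymmetric le.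
  case=> [a|] [b|]//=; first by move=> /le_anti ->.
  - by case/andP=> /asboolP La /asboolP Ua; case: LU0; exists a.
  - by case/andP=> /asboolP Ub /asboolP Lb; case: LU0; exists b.
have le_tr : transitive le.
  case=> [b|] [a|] [c|]//=; first exact: le_trans.
  - by move=> ab /asboolP[s Ss bs]; apply/asboolP; exists s => //; apply: le_trans bs.
  - by move=> /asboolP[t Tt tb] bc; apply/asboolP; exists t => //; apply: le_trans bc.
  - by move=> /asboolP La /asboolP Uc; apply: leLU.
pose X : porderType d := HB.pack (option Y)
  (Order.Le_isPOrder.Build d (option Y) le_refl le_anti le_tr).
(* The subset is the copy of [Y] inside [X]; the chosen [f] is the inverse of [Some] on it. *)
have someE (a : ([set x | isSome x] : set X)) : exists y, \val a = Some y.
  by case: a => -[y|] /= /set_mem//; exists y.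
have [f fE] := choice someE.
have [|Psi [Psi_homo PsiE]] := ext X _ f.
  move=> a b ab; have: le (\val a) (\val b) by [].
  by rewrite !fE.
have Psi_some y : Psi (Some y) = y.
  have y_some : (Some y : X) \in [set x | isSome x] by apply/mem_set.
  have := PsiE (exist _ (Some y) y_some); rewrite /= => ->.
  by have [] := fE (exist _ (Some y) y_some).
exists (Psi None); split=> [s Ss|t Tt].
- rewrite -[s in s <= _]Psi_some; apply: Psi_homo.
  by apply/asboolP; exists s.
- rewrite -[t in _ <= t]Psi_some; apply: Psi_homo.
  by apply/asboolP; exists t.
Qed.

Theorem theorem2p6 (dY : Order.disp_t) (Y : porderType dY)
    (Y_nonempty : nonempty [set: Y]%classic) :
  [<-> complete_lattice Y;
       forall (dX : Order.disp_t) (X : porderType dX) (A : set X) (f : A -> Y),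
         Order.nondecreasing f ->
         exists Psi : X -> Y, lower_isotone_extension f Psi;
       forall (dX : Order.disp_t) (X : porderType dX) (A : set X) (f : A -> Y),
         Order.nondecreasing f ->
         exists Psi : X -> Y, upper_isotone_extension f Psi;
       forall (dX : Order.disp_t) (X : porderType dX) (A : set X) (f : A -> Y),
         Order.nondecreasing f ->
         exists Psi : X -> Y, isotone_extension f Psi].
Proof.
have sup_of_complete : complete_lattice Y -> forall S : set Y, supremums S !=set0.
  move=> cY S; have [->|/set0P/cY[]//] := eqVneq S set0.
  by have [_ [z /supremums_set0]] := cY _ Y_nonempty; exists z.
have inf_of_complete : complete_lattice Y -> forall S : set Y, infimums S !=set0.
  move=> cY S; have [->|/set0P/cY[]//] := eqVneq S set0.
  have [[z supz] _] := cY _ Y_nonempty.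
  by exists z; apply: (@supremums_set0 _ Y^d).
have complete_of_ext :
    (forall (dX : Order.disp_t) (X : porderType dX) (A : set X) (f : A -> Y),
      Order.nondecreasing f -> exists Psi : X -> Y, isotone_extension f Psi) ->
    complete_lattice Y.
  move=> ext S _; split.
    (* An upper bound of [S] that lies below all upper bounds of [S] is its supremum. *)
    have [|z [Sz zU]] := @isotone_extension_interpolation _ Y S (ubound S) (ext _).
      by move=> s t Ss; apply.
    by exists z.
  have [|z [Lz zS]] := @isotone_extension_interpolation _ Y (lbound S) S (ext _).
    by move=> s t Ls St; apply: Ls.
  by exists z.
tfae.
- by move=> cY dX X A f; apply/lower_isotone_extension_sup/sup_of_complete.
(* This step passes through completeness: lower extensions are extensions, so [Y] is a complete
   lattice and has all infima. *)
- move=> low dX X A f; apply/upper_isotone_extension_inf/inf_of_complete.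
  apply: complete_of_ext => {dX X A f}dX X A f /low[Psi [PsiE _]].
  by exists Psi.
- by move=> upp dX X A f /upp[Psi [PsiE _]]; exists Psi.
- exact: complete_of_ext.
Qed.
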